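(* Let $t>s\ge 2$ and $n\ge 3t-3$ be integers. Then $$\mathrm{wsat}(K_n,K_{s,t})\ge (s-1)(n-t+1)+\binom{t}{2}.$$
   Context: All graphs are finite and simple; $K_n$ is the complete graph on $n$ vertices and $K_{a,b}$ is the complete bipartite graph with parts of sizes $a$ and $b$. A copy of a graph $H$ in a graph $G$ is a (not necessarily induced) subgraph of $G$ isomorphic to $H$. Let $F$ and $H$ be graphs. A spanning subgraph $G$ of $F$ is weakly $(F,H)$-saturated if $G$ contains no copy of $H$, but there is an ordering $e_1,\ldots,e_k$ of $E(F)\setminus E(G)$ such that for each $i\in\{1,\dots,k\}$ the graph $G\cup\{e_1,\ldots,e_i\}$ contains a copy $H'$ of $H$ with $e_i\in E(H')$. The weak saturation number $\mathrm{wsat}(F,H)$ is the minimum number of edges of a weakly $(F,H)$-saturated graph. *)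

(* Defs.v *)
From HB Require Import structures.
From mathcomp Require Import all_boot.

Set Implicit Arguments.
Unset Strict Implicit.
Unset Printing Implicit Defensive.

(* Finite simple graphs with vertex set T; an edge is a 2-element set. *)
Record sgraph (T : finType) := SGraph {
  edges : {set {set T}};
  edges_card2 : [forall e in edges, #|e| == 2] }.

HB.instance Definition _ (T : finType) := [isSub of sgraph T for @edges T].
HB.instance Definition _ (T : finType) := [Finite of sgraph T by <:].

Fact complete_card2 n : [forall e in [set e : {set 'I_n} | #|e| == 2], #|e| == 2].
Proof. by apply/forall_inP => e; rewrite inE. Qed.

Definition complete n : sgraph 'I_n := SGraph (complete_card2 n).

Fact complete_bipartite_card2 a b :
  [forall e in [set [set inl i; inr j] | i : 'I_a, j : 'I_b],
    #|e| == 2].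
Proof. by apply/forall_inP => e /imset2P[i j _ _ ->]; rewrite cards2. Qed.

Definition complete_bipartite a b : sgraph ('I_a + 'I_b)%type :=
  SGraph (complete_bipartite_card2 a b).

Section WeakSaturation.
Variables (T U : finType).
Implicit Types (F G : sgraph T) (H : sgraph U) (A B : {set {set T}}).

(* B is the edge set of a copy of H in the graph (T, A).  The vertex set of   *)
(* the copy is the image of f, so isolated vertices of H are accounted for.   *)
Definition is_copy H A B : bool :=
  (B \subset A) &&
  [exists f : {ffun U -> T},
    injectiveb f && (B == [set f @: e | e : {set U} in edges H])].

Definition contains_copy H A : bool := [exists B, is_copy H A B].

Definition contains_copy_with H A (x : {set T}) : bool :=
  [exists B, is_copy H A B && (x \in B)].

(* The i-th edge is indexed from 0, so that G together with the edges up to   *)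
(* and including the i-th one has the added edges take i.+1 es.               *)
Definition saturating_order G H (es : seq {set T}) : bool :=
  [forall i : 'I_(size es),
    contains_copy_with H (edges G :|: [set:: take i.+1 es]) (nth set0 es i)].

Definition weakly_saturated F H G : bool :=
  [&& edges G \subset edges F,
      ~~ contains_copy H (edges G) &
      has (saturating_order G H) (permutations (enum (edges F :\: edges G)))].

(* The default value #|edges F| bounds #|edges G| for every spanning subgraph *)
(* G of F, so it does not affect the minimum over a nonempty range; the range *)
(* is nonempty as soon as H has an edge (wsat_attained).                      *)
Definition wsat F H : nat :=
  \big[minn/#|edges F|]_(G : sgraph T | weakly_saturated F H G) #|edges G|.

Lemma wsat_le F H G : weakly_saturated F H G -> wsat F H <= #|edges G|.
Proof.
move=> wG; rewrite /wsat -big_filter.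
have: G \in [seq G' <- index_enum (sgraph T) | weakly_saturated F H G'].
  by rewrite mem_filter wG mem_index_enum.
elim: [seq _ <- _ | _] => //= G' r IH; rewrite in_cons big_cons geq_min.
by case/predU1P => [->|/IH ->]; rewrite ?leqnn ?orbT.
Qed.

Lemma weakly_saturated_exists F H :
  edges H != set0 -> exists G, weakly_saturated F H G.
Proof.
move=> /set0Pn[h hH].
suff: forall k G, #|edges G| <= k -> edges G \subset edges F ->
    has (saturating_order G H) (permutations (enum (edges F :\: edges G))) ->
    exists G', weakly_saturated F H G'.
  move/(_ #|edges F| F (leqnn _) (subxx _)); apply.
  apply/hasP; exists [::]; first by rewrite setDv mem_permutations enum_set0.
  by apply/forallP => -[].
elim=> [|k IH] G leGk sGF oG; have [cG|ncG] := boolP (contains_copy H (edges G));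
  try by exists G; rewrite /weakly_saturated sGF ncG oG.
  case/existsP: cG => B /andP[sBG /existsP[f /andP[_ /eqP defB]]].
  move: leGk; rewrite leqn0 cards_eq0 => /eqP G0.
  by have:= subsetP sBG (f @: h); rewrite G0 inE defB imset_f // => /(_ isT).
case/existsP: (cG) => B cB; case/andP: (cB) => sBG /existsP[f /andP[_ /eqP defB]].
pose x := f @: h.
have xB : x \in B by rewrite defB imset_f.
have xG : x \in edges G := subsetP sBG x xB.
have G'2 : [forall e in edges G :\ x, #|e| == 2].
  apply/forall_inP => e /setD1P[_ eG].
  exact: (forall_inP (edges_card2 G)) e eG.
apply: (IH (SGraph G'2)) => /=.
- by move: leGk; rewrite (cardsD1 x) xG.
- exact: subset_trans (subsetDl _ _) sGF.
case/hasP: oG => es; rewrite mem_permutations => pes /forallP oes.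
apply/hasP; exists (x :: es).
  rewrite mem_permutations; apply: uniq_perm; last 2 first.
  - exact: enum_uniq.
  - move=> y; rewrite in_cons (perm_mem pes) !mem_enum !inE.
    case: (eqVneq y x) => [->|//] /=.
    by rewrite (subsetP sGF x xG).
  by rewrite /= (perm_mem pes) mem_enum inE xG (perm_uniq pes) enum_uniq.
have eqU (A : {set {set T}}) : edges G :\ x :|: (x |: A) = edges G :|: A.
  by rewrite setUA (setUC _ [set x]) setD1K.
apply/forallP => -[[|i] /= lti]; rewrite /= ?take0 set_cons eqU.
  by apply/existsP; exists B; rewrite xB andbT set_nil setU0.
exact: (oes (Ordinal (lti : i < size es))).
Qed.

Lemma wsat_attained F H :
  edges H != set0 ->
  exists2 G, weakly_saturated F H G & #|edges G| = wsat F H.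
Proof.
move=> /(@weakly_saturated_exists F H)[G0 wG0].
case: (arg_minnP (fun G => #|edges G|) wG0) => G wG minG; exists G => //.
apply/eqP; rewrite eqn_leq wsat_le // andbT /wsat.
elim/big_ind: _ => [|m n lem len|G' /minG //]; last by rewrite leq_min lem len.
by case/and3P: wG => /subset_leq_card.
Qed.

End WeakSaturation.

(* Main.v *)
Require Import Defs.
From mathcomp Require Import all_boot all_order all_algebra zify ring.

(* Put m = s - 1 and r = t - s, and give the edge {a,b} of K_n the weight       *)
(*   p_a(b) + p_b(a) + g(a) g(b) (Q(a,b) + Q(b,a)),                             *)
(* where the p_v are polynomials of degree < m, g(x) = x (x-1) ... (x-m+1), and *)
(* Q has degree < r in each variable.  Choosing alpha on the s-side and beta on *)
(* the t-side of a copy of K_{s,t} to annihilate the polynomials of degree      *)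
(* < s - 1 and < t - 1 at the vertices, the weights of the copy satisfy         *)
(* sum alpha_a beta_b w(ab) = 0, and all alpha_a, beta_b are nonzero.  So a     *)
(* weight vanishing on a weakly saturated graph vanishes on K_n.  After         *)
(* normalisation (p_v(i) = 0 for v < i < m, and Q triangular) the weights       *)
(* depend injectively on exactly (s-1)(n-t+1) + C(t,2) parameters, so no graph  *)
(* with fewer edges can be weakly saturated.                                    *)

Set Implicit Arguments.
Unset Strict Implicit.
Unset Printing Implicit Defensive.

Import Order.TTheory GRing.Theory Num.Theory.

(** The bound is a dimension count for a linear space of edge weights on the complete graph. Every
    copy of the bipartite graph imposes on these weights one linear relation whose coefficients are
    all nonzero ([vandermonde_relation], [weight_relation]). Hence a weight that vanishes on all
    edges of a copy but one vanishes on the last one too, and vanishing spreads along the saturation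
    process ([weakly_saturated_closed]). If G had fewer edges than there are free parameters
    ([card_free_params]), then [nontrivial_solution] would give a nonzero parameter vector whose
    weight vanishes on G, hence on every edge, against [weight_injective]. *)

(** * Propagation along a saturating order *)

Lemma weakly_saturated_closed (T U : finType) (F G : sgraph T) (H : sgraph U)
    (Z : pred {set T}) :
  (forall f : {ffun U -> T}, injective f -> forall e0, e0 \in edges H ->
     (forall e, e \in edges H -> e != e0 -> Z (f @: e)) -> Z (f @: e0)) ->
  weakly_saturated F H G ->
  (forall e, e \in edges G -> Z e) -> forall e, e \in edges F -> Z e.
Proof.
move=> closedZ /and3P[_ _ /hasP[es]].
rewrite mem_permutations => pes /forallP oes ZG.
have Zes i : i < size es -> Z (nth set0 es i).
  elim/ltn_ind: i => i IH lti.
  have /existsP[B /andP[/andP[sB /existsP[f /andP[/injectiveP injf /eqP defB]]]]] :=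
    oes (Ordinal lti).
  rewrite defB /= => /imsetP[e0 e0H eq_e0]; rewrite eq_e0.
  apply: (closedZ f injf _ e0H) => e eH ne.
  have := subsetP sB (f @: e); rewrite defB imset_f // => /(_ isT).
  rewrite in_setU => /orP[/ZG //|].
  rewrite inE => eTake.
  have := eTake; rewrite -(nth_index set0 eTake).
  have : index (f @: e) (take i.+1 es) < size (take i.+1 es) by rewrite index_mem.
  rewrite size_take_min leq_min => /andP[lei ltes].
  move=> _; rewrite nth_take //; apply: IH => //.
  (* An edge of the copy other than the new one was added strictly earlier: index i would give it
     the same image as [e0], and [f] is injective. *)
  rewrite ltn_neqAle -ltnS lei andbT; apply: contra_neq ne => idx.
  apply: (imset_inj injf); rewrite -eq_e0 -(nth_index set0 eTake) idx.
  by rewrite nth_take.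
move=> e eF; have [/ZG //|eG] := boolP (e \in edges G).
have ees : e \in es by rewrite (perm_mem pes) mem_enum inE eG eF.
by rewrite -(nth_index set0 ees); apply: Zes; rewrite index_mem.
Qed.

Lemma big_prod_type (R : Type) (idx : R) (op : Monoid.com_law idx)
    (I J : finType) (F : I * J -> R) :
  \big[op/idx]_p F p = \big[op/idx]_i \big[op/idx]_j F (i, j).
Proof. by rewrite pair_bigA; apply: eq_bigr => -[]. Qed.

Lemma bin2D a b : 'C(a + b, 2) = 'C(a, 2) + 'C(b, 2) + a * b.
Proof.
elim: b => [|b IH]; first by rewrite addn0 muln0 !addn0.
by rewrite addnS !binS !bin1 IH; lia.
Qed.

(** * Linear relations and annihilating coefficients *)

Local Open Scope ring_scope.

(** More unknowns ([P]) than equations ([E]): a nonzero vector of the left kernel, extended by zero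
    outside [P]. *)
Lemma nontrivial_solution (K : fieldType) (I J : finType) (P : {set I})
    (E : {set J}) (A : I -> J -> K) :
  (#|E| < #|P|)%N ->
  exists theta : I -> K,
    [/\ exists x, theta x != 0, forall x, x \notin P -> theta x = 0
      & forall y, y \in E -> \sum_x theta x * A x y = 0].
Proof.
move=> ltEP; pose M := \matrix_(i < #|P|, j < #|E|) A (enum_val i) (enum_val j).
have /rowV0Pn[v /sub_kermxP vM v0] : kermx M != 0.
  by rewrite -mxrank_eq0 mxrank_ker -lt0n subn_gt0 (leq_ltn_trans (rank_leq_col M)).
pose theta x := \sum_(i < #|P| | enum_val i == x) v 0 i.
exists theta; split.
- case/rV0Pn: v0 => i vi; exists (enum_val i); rewrite /theta.
  rewrite (big_pred1 i) // => j; exact: (inj_eq enum_val_inj).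
- move=> x xP; rewrite /theta big_pred0 // => i.
  by apply: contraNF xP => /eqP <-; apply: enum_valP.
- move=> y yE; have := congr1 (fun u : 'rV_#|E| => u 0 (enum_rank_in yE y)) vM.
  rewrite !mxE => eq0; rewrite -[RHS]eq0; under eq_bigr do rewrite /theta big_distrl /=.
  rewrite (exchange_big_dep predT) //=; apply: eq_bigr => i _.
  by rewrite (big_pred1 (enum_val i)) ?mxE ?enum_rankK_in // => x; rewrite eq_sym.
Qed.

Lemma vandermonde_relation (K : fieldType) (d : nat) (h : 'I_d.+1 -> K) :
  injective h ->
  exists beta : 'I_d.+1 -> K,
    (forall j, beta j != 0) /\
    (forall p : {poly K}, (size p <= d)%N -> \sum_j beta j * p.[h j] = 0).
Proof.
move=> injh.
have [|beta [[j0 bj0] _ betaX]] :=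
    @nontrivial_solution K 'I_d.+1 'I_d setT setT (fun j k => h j ^+ k).
  by rewrite !cardsT !card_ord.
have betaP (p : {poly K}) : (size p <= d)%N -> \sum_j beta j * p.[h j] = 0.
  move=> szp; under eq_bigr do rewrite (horner_coef_wide _ szp) big_distrr /=.
  rewrite exchange_big big1 //= => k _.
  transitivity (p`_k * \sum_j beta j * h j ^+ k); last by rewrite betaX ?inE ?mulr0.
  by rewrite big_distrr; apply: eq_bigr => j _; rewrite /= mulrCA.
(* If [beta j1] were 0, test the relation on the polynomial of degree d - 1 vanishing at all nodes
   except those of j0 and j1: only the j0 term survives, so [beta j0] would be 0. *)
exists beta; split=> // j1; apply: contra_neq bj0 => bj1.
have [-> //|ne01] := eqVneq j0 j1.
pose C := [predC pred2 j0 j1].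
pose p := \prod_(a <- image h C) ('X - a%:P).
have rootp j : root p (h j) = (j \in C) by rewrite root_prod_XsubC mem_image.
have szp : (size p <= d)%N.
  rewrite size_prod_XsubC size_image.
  have cardCE : (#|pred2 j0 j1| + #|C| = d.+1)%N by rewrite cardC card_ord.
  by rewrite -ltnS -[leqRHS]cardCE card2 ne01.
have := betaP p szp; rewrite (bigD1 j0) //= [X in _ + X]big1 ?addr0.
  by move/eqP; rewrite mulf_eq0 => /orP[/eqP //|]; rewrite -/(root p _) rootp !inE eqxx.
move=> j nj; have [->|nj1] := eqVneq j j1; first by rewrite bj1 mul0r.
have /rootP -> : root p (h j) by rewrite rootp !inE negb_or nj.
exact: mulr0.
Qed.

(** * Polynomials with prescribed natural roots *)

Definition node_poly (s : seq nat) : {poly rat} := \prod_(v <- s) ('X - (v%:R)%:P).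

Lemma size_node_poly s : size (node_poly s) = (size s).+1.
Proof. exact: size_prod_XsubC. Qed.

Lemma horner_node_poly_eq0 s (v : nat) : ((node_poly s).[v%:R] == 0) = (v \in s).
Proof.
have -> : node_poly s = \prod_(x <- [seq v%:R | v <- s]) ('X - x%:P).
  by rewrite big_map.
rewrite -[LHS]/(root _ _) root_prod_XsubC.
by rewrite mem_map // => x y /eqP; rewrite eqr_nat => /eqP.
Qed.

Lemma node_roots_eq0 (p : {poly rat}) (s : seq nat) :
  uniq s -> (size p <= size s)%N -> {in s, forall v, p.[v%:R] = 0} -> p = 0.
Proof.
move=> us szp ps.
apply: (@roots_geq_poly_eq0 _ _ [seq v%:R | v <- s]); last by rewrite size_map.
  by rewrite all_map; apply/allP => v /ps /= /eqP.
by rewrite map_inj_uniq // => x y /eqP; rewrite eqr_nat => /eqP.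
Qed.

Lemma coef_sum_Xn (K : nzRingType) d (c : 'I_d -> K) (l : 'I_d) :
  (\sum_k c k *: 'X^k)`_l = c l.
Proof.
rewrite coef_sum (bigD1 l) //= big1 ?addr0 => [|k nk].
  by rewrite coefZ coefXn eqxx mulr1.
by rewrite coefZ coefXn eq_sym -val_eqE /= in nk *; rewrite (negPf nk) mulr0.
Qed.

Lemma size_sum_Xn (K : nzRingType) d (c : 'I_d -> K) :
  (size (\sum_k c k *: 'X^k)%R <= d)%N.
Proof.
apply: leq_trans (size_sum _ _ _) _; apply/bigmax_leqP => k _.
by rewrite (leq_trans (size_scale_leq _ _)) // size_polyXn.
Qed.

(** * The space of weights *)

Section Weights.
Variables m r n : nat.

Definition nodal : {poly rat} := node_poly (iota 0 m).

(* Lagrange polynomials at 0, ..., m - 1, not normalised. *)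
Definition lag (i : nat) : {poly rat} := node_poly (rem i (iota 0 m)).

Definition param : finType := ('I_n * 'I_m + 'I_r * 'I_r)%type.

(* The inl coordinates are the Lagrange coefficients of the p_v, the inr       *)
(* coordinates the coefficients of Q; row_poly x a is p_a + g(a) g Q(a, -).     *)
Definition row_poly (x : param) (a : nat) : {poly rat} :=
  match x with
  | inl (j, i) => (a == j)%:R *: lag i
  | inr (k, l) => (nodal.[a%:R] * a%:R ^+ k) *: (nodal * 'X^l)
  end.

Definition weight (x : param) (a b : nat) : rat :=
  (row_poly x a).[b%:R] + (row_poly x b).[a%:R].

(** The normalisation removes redundancy: for v < i < m the edge {v,i} sees only p_v(i) + p_i(v),
    since g vanishes there, and Q enters only through its symmetrisation. *)
Definition free_params : {set param} :=
  [set x : param | match x with inl (j, i) => i <= j | inr (k, l) => k <= l end]%N.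

Lemma nodal_eq0 v : (nodal.[v%:R] == 0) = (v < m)%N.
Proof. by rewrite horner_node_poly_eq0 mem_iota. Qed.

Lemma lag_eq0 (i : 'I_m) v : ((lag i).[v%:R] == 0) = (v != i) && (v < m)%N.
Proof. by rewrite horner_node_poly_eq0 mem_rem_uniq ?iota_uniq // inE mem_iota. Qed.

Lemma size_nodal : size nodal = m.+1.
Proof. by rewrite size_node_poly size_iota. Qed.

Lemma size_lag (i : 'I_m) : size (lag i) = m.
Proof.
rewrite size_node_poly size_rem ?mem_iota //= size_iota prednK //.
exact: leq_ltn_trans (ltn_ord i).
Qed.

Lemma size_nodal_Xn (k : 'I_r) : (size (nodal * 'X^k)%R <= m + r)%N.
Proof.
apply: leq_trans (size_polyMleq _ _) _.
rewrite size_nodal size_polyXn addSn leq_add2l; exact: ltn_ord.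
Qed.

(** Every term dies on one side of the copy. [beta] kills p_a for a on the [f] side, and all
    Q-terms, which have degree less than m + r in either variable; [alpha] is needed only for p_b
    with b on the [g] side, of degree less than m. *)
Lemma weight_relation (s t : nat) (x : param) (f : 'I_s -> nat) (g : 'I_t -> nat)
    (alpha : 'I_s -> rat) (beta : 'I_t -> rat) :
  (forall p : {poly rat}, (size p <= m)%N -> \sum_i alpha i * p.[(f i)%:R] = 0) ->
  (forall p : {poly rat}, (size p <= m + r)%N -> \sum_j beta j * p.[(g j)%:R] = 0) ->
  \sum_i \sum_j alpha i * beta j * weight x (f i) (g j) = 0.
Proof.
move=> alphaP betaP.
transitivity (\sum_i \sum_j alpha i * (beta j * (row_poly x (f i)).[(g j)%:R]) +
              \sum_i \sum_j alpha i * (beta j * (row_poly x (g j)).[(f i)%:R])).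
  rewrite -big_split; apply: eq_bigr => i _; rewrite -big_split.
  by apply: eq_bigr => j _; rewrite /= /weight mulrDr !mulrA.
rewrite [X in X + _]big1 ?add0r => [|i _].
  case: x => [[a i0]|[k l]].
    rewrite exchange_big big1 //= => j _.
    transitivity (beta j * \sum_i alpha i * ((g j == a)%:R *: lag i0).[(f i)%:R]).
      by rewrite big_distrr; apply: eq_bigr => i _; rewrite /= mulrCA.
    by rewrite alphaP ?mulr0 // (leq_trans (size_scale_leq _ _)) ?size_lag.
  rewrite big1 // => i _; rewrite -big_distrr /=.
  transitivity (alpha i * ((nodal * 'X^l).[(f i)%:R] *
      \sum_j beta j * (nodal * 'X^k).[(g j)%:R])).
    congr (_ * _); rewrite big_distrr; apply: eq_bigr => j _.
    rewrite !hornerE /=; ring.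
  by rewrite betaP ?size_nodal_Xn // !mulr0.
rewrite -big_distrr /= betaP ?mulr0 //.
case: x => [[a i0]|[k l]] /=; apply: leq_trans (size_scale_leq _ _) _.
  by rewrite size_lag leq_addr.
exact: size_nodal_Xn.
Qed.

Lemma horner_row_sum (theta : param -> rat) (a : 'I_n) (b : nat) :
  \sum_x theta x * (row_poly x a).[b%:R] =
  \sum_i theta (inl (a, i)) * (lag i).[b%:R] +
  nodal.[a%:R] * nodal.[b%:R] *
    \sum_k \sum_l theta (inr (k, l)) * a%:R ^+ k * b%:R ^+ l.
Proof.
rewrite big_sumType !big_prod_type /=; congr (_ + _).
  rewrite (bigD1 a) //= [X in _ + X]big1 ?addr0 => [|j nj].
    by apply: eq_bigr => i _; rewrite eqxx scale1r.
  apply: big1 => i _; rewrite [_ == _](_ : _ = false) ?scale0r ?horner0 ?mulr0 //.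
  by apply: contra_neqF nj => /eqP/val_inj.
rewrite big_distrr; apply: eq_bigr => k _; rewrite big_distrr.
by apply: eq_bigr => l _; rewrite !hornerE /=; ring.
Qed.

(** Edges meeting {0, ..., m-1} tie all the p_v to m scalars; on the other vertices root counting
    then kills the p_v and the symmetrised Q, and triangularity kills Q. *)
Lemma weight_injective (theta : param -> rat) :
  (m + m + r < n)%N ->
  (forall x, x \notin free_params -> theta x = 0) ->
  (forall a b : 'I_n, a != b -> \sum_x theta x * weight x a b = 0) ->
  forall x, theta x = 0.
Proof.
move=> ltn supp edge0.
pose A (a : 'I_n) (i : 'I_m) := theta (inl (a, i)).
pose q k l := theta (inr (k, l)).
pose p (a b : nat) := \sum_(x : param) theta x * (row_poly x a).[b%:R].
have pE (a : 'I_n) (b : nat) : p a b = \sum_i A a i * (lag i).[b%:R] +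
    nodal.[a%:R] * nodal.[b%:R] * \sum_k \sum_l q k l * a%:R ^+ k * b%:R ^+ l.
  exact: horner_row_sum.
have p_sym (a b : 'I_n) : a != b -> p a b + p b a = 0.
  move=> /edge0 <-; rewrite -big_split; apply: eq_bigr => x _; exact: esym (mulrDr _ _ _).
have nodal0 (v : nat) : (v < m)%N -> nodal.[v%:R] = 0.
  by move=> ltv; apply/eqP; rewrite nodal_eq0.
have lag0 (i k : 'I_m) : i != k -> (lag i).[(k : nat)%:R] = 0.
  by move=> nik; apply/eqP; rewrite lag_eq0 ltn_ord eq_sym nik.
have lagii (i : 'I_m) : (lag i).[(i : nat)%:R] != 0.
  by rewrite lag_eq0 eqxx.
have lag_neq0 (i : 'I_m) (v : nat) : (m <= v)%N -> (lag i).[v%:R] != 0.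
  by move=> lev; rewrite lag_eq0 ltnNge lev andbF.
have lagsum (c : 'I_m -> rat) (i : 'I_m) :
    \sum_k c k * (lag k).[(i : nat)%:R] = c i * (lag i).[(i : nat)%:R].
  by rewrite (bigD1 i) //= big1 ?addr0 // => k nk; rewrite lag0 ?mulr0.
have pEr (a : 'I_n) (i : 'I_m) : p a i = A a i * (lag i).[(i : nat)%:R].
  by rewrite pE (nodal0 i) // mulr0 mul0r addr0 lagsum.
have lemn : (m <= n)%N by lia.
pose w (i : 'I_m) := widen_ord lemn i.
have A_upper (i k : 'I_m) : (i < k)%N -> A (w i) k = 0.
  by move=> ltik; apply: supp; rewrite inE -ltnNge.
have A_diag (i k : 'I_m) : i != k -> A (w i) k = 0.
  move=> nik; have [/A_upper //|ltki|/val_inj eqik] := ltngtP i k; last first.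
    by rewrite eqik eqxx in nik.
  have := p_sym (w i) (w k) nik.
  rewrite [p _ _]pEr [p (w k) _]pEr (A_upper k i ltki) mul0r addr0.
  by move/eqP; rewrite mulf_eq0 (negPf (lagii k)) orbF => /eqP.
have pEl (i : 'I_m) (b : nat) : p (w i) b = A (w i) i * (lag i).[b%:R].
  rewrite pE (nodal0 i) // !mul0r addr0 (bigD1 i) //= big1 ?addr0 // => k nk.
  by rewrite A_diag ?mul0r // eq_sym.
(* On an edge {i,a} with i < m <= a the Q-part vanishes, so the coefficient [A a i] is [(lag i).[a]]
   times a scalar depending only on i. *)
have A_low (a : 'I_n) (i : 'I_m) : (m <= a)%N ->
    A a i * (lag i).[(i : nat)%:R] = - (A (w i) i * (lag i).[(a : nat)%:R]).
  move=> lema; have nia : w i != a by rewrite -val_eqE /=; have := ltn_ord i; lia.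
  have := p_sym _ _ nia; rewrite pEl [p a _]pEr => /eqP; rewrite addrC addr_eq0.
  by move/eqP.
have A_swap (a b : 'I_n) (i : 'I_m) : (m <= a)%N -> (m <= b)%N ->
    A b i * (lag i).[(a : nat)%:R] = A a i * (lag i).[(b : nat)%:R].
  move=> lea leb; apply: (mulIf (lagii i)).
  by rewrite mulrAC A_low // [RHS]mulrAC A_low //; ring.
(* [S a] is Q(a,-) + Q(-,a). By [A_swap], p_a(b) = p_b(a) for vertices at least m, whence the factor
   2 in [R]. *)
pose S (a : 'I_n) : {poly rat} :=
  \sum_l (\sum_k (q k l + q l k) * (a : nat)%:R ^+ k) *: 'X^l.
pose R (a : 'I_n) : {poly rat} :=
  2%:R *: (\sum_i A a i *: lag i) + nodal.[(a : nat)%:R] *: (nodal * S a).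
have SE (a b : 'I_n) : (S a).[(b : nat)%:R] =
    \sum_k \sum_l q k l * (a : nat)%:R ^+ k * (b : nat)%:R ^+ l +
    \sum_k \sum_l q k l * (b : nat)%:R ^+ k * (a : nat)%:R ^+ l.
  rewrite [X in X + _]exchange_big -big_split horner_sum; apply: eq_bigr => l _.
  rewrite !hornerE big_distrl -big_split; apply: eq_bigr => k _ /=; ring.
(* The weight of {a, b} for b >= m, b != a, is R_a(b): these are at least      *)
(* m + r roots of R_a.                                                         *)
have R0 (a : 'I_n) : (m <= a)%N -> R a = 0.
  move=> lea; apply: (@node_roots_eq0 _ (rem (a : nat) (iota m (n - m)))).
  - by rewrite rem_uniq ?iota_uniq.
  - rewrite size_rem ?mem_iota ?lea ?subnKC ?ltn_ord // size_iota.
    (* There are n - m - 1 nodes once a is removed; [m + m + r < n] makes this at least m + r. *)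
    apply: leq_trans (_ : m + r <= _)%N; last lia.
    apply: leq_trans (size_polyD _ _) _; rewrite geq_max.
    apply/andP; split; apply: leq_trans (size_scale_leq _ _) _.
      apply: leq_trans (size_sum _ _ _) _; apply/bigmax_leqP => i _.
      by apply: leq_trans (size_scale_leq _ _) _; rewrite size_lag leq_addr.
    apply: leq_trans (size_polyMleq _ _) _.
    by rewrite size_nodal addSn leq_add2l size_sum_Xn.
  move=> v; rewrite mem_rem_uniq ?iota_uniq // inE mem_iota subnKC // => /and3P[/= nva lev ltv].
  pose b := Ordinal ltv; have nab : a != b by rewrite eq_sym.
  rewrite -[RHS](p_sym a b nab) 2!pE /R hornerD !hornerZ hornerM (SE a b) horner_sum.
  under eq_bigr do rewrite hornerZ.
  rewrite [X in _ = _ + (X + _)](eq_bigr _ (fun i _ => A_swap a b i lea lev)).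
  by rewrite -!/b /=; ring.
(* At i < m the factor g kills the Q-part of [R a], leaving 2 p_a(i). *)
have A_last (a : 'I_n) (i : 'I_m) : (m <= a)%N -> A a i = 0.
  move=> lea; have := congr1 (fun P : {poly rat} => P.[(i : nat)%:R]) (R0 a lea).
  rewrite /R hornerD !hornerZ hornerM (nodal0 i) // mul0r mulr0 addr0 horner0 horner_sum.
  under eq_bigr do rewrite hornerZ.
  rewrite lagsum => /eqP; rewrite !mulf_eq0 pnatr_eq0 (negPf (lagii i)) orbF /=.
  by move/eqP.
have A0 a i : A a i = 0.
  have [/A_last //|lta] := leqP m a.
  have -> : a = w (Ordinal lta) by apply: val_inj.
  have [->|/A_diag //] := eqVneq (Ordinal lta) i.
  (* For a < m only the diagonal scalar is left; comparing with vertex m, where [lag i] is nonzero,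
     kills it. *)
  have ltmn : (m < n)%N by lia.
  have := A_low (Ordinal ltmn) i (leqnn m); rewrite A_last // mul0r => /esym/eqP.
  by rewrite oppr_eq0 mulf_eq0 (negPf (lag_neq0 _ _ (leqnn m))) orbF => /eqP.
have S0 (a : 'I_n) : (m <= a)%N -> S a = 0.
  move=> lea; have := R0 a lea; rewrite /R big1 ?scaler0 ?add0r => [|i _]; last first.
    by rewrite A0 scale0r.
  move/eqP; rewrite scaler_eq0 nodal_eq0 ltnNge lea /= mulf_eq0 -size_poly_eq0.
  by rewrite size_nodal => /eqP.
(* The l-th coefficient of [S a] is a polynomial in a of degree less than r with the n - m roots m,
   ..., n - 1. *)
have q_sym k l : q k l + q l k = 0.
  pose P : {poly rat} := \sum_k (q k l + q l k) *: 'X^k.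
  suff P0 : P = 0 by rewrite -(coef_sum_Xn (fun k => q k l + q l k)) -/P P0 coef0.
  apply: (@node_roots_eq0 _ (iota m (n - m))); first exact: iota_uniq.
    by rewrite size_iota (leq_trans (size_sum_Xn _)) //; lia.
  move=> v; rewrite mem_iota subnKC // => /andP[lev ltv].
  have := congr1 (fun P : {poly rat} => P`_l) (S0 (Ordinal ltv) lev).
  rewrite coef_sum_Xn coef0 => <-; rewrite horner_sum; apply: eq_bigr => j _.
  by rewrite !hornerE.
have q_low (k l : 'I_r) : (l < k)%N -> q k l = 0.
  by move=> ltlk; apply: supp; rewrite inE -ltnNge.
case=> [[a i]|[k l]]; first exact: A0.
have [ltkl|/q_low //|/val_inj eqkl] := ltngtP k l.
  by have := q_sym k l; rewrite (q_low l k) // addr0.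
by have := q_sym k l; rewrite eqkl => /eqP; rewrite -mulr2n mulrn_eq0 /= => /eqP.
Qed.

(** Summing over ordered pairs makes the weight a function of the unordered edge, with no choice of
    endpoints. *)
Definition edge_weight (x : param) (e : {set 'I_n}) : rat :=
  \sum_(u in e) \sum_(v in e :\ u) (row_poly x u).[(v : nat)%:R].

Lemma edge_weight2 x (a b : 'I_n) :
  a != b -> edge_weight x [set a; b] = weight x a b.
Proof.
move=> nab; have nba : b != a by rewrite eq_sym.
rewrite /edge_weight big_setU1 ?inE //= big_set1 setU1K ?inE // setUC setU1K ?inE //.
by rewrite !big_set1.
Qed.

Lemma card_free_params :
  (m <= n)%N -> #|free_params| = (m * (n - m) + 'C(m.+1, 2) + 'C(r.+1, 2))%N.
Proof.
have sum_leq d i : (\sum_(j < d) (i <= j) = d - i)%N.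
  by elim: d => [|d IH]; rewrite ?big_ord0 // big_ord_recr /= IH; lia.
have sum_sub k d : (k <= d)%N -> (\sum_(i < k) (d - i) = k * (d - k) + 'C(k.+1, 2))%N.
  elim: k => [|k IH] ltkd; first by rewrite big_ord0.
  by rewrite big_ord_recr /= IH 1?ltnW // [in RHS]binS bin1; nia.
move=> lemn; rewrite -sum1_card big_mkcond big_sumType /= !big_prod_type; congr (_ + _)%N.
  rewrite exchange_big -sum_sub //; apply: eq_bigr => i _.
  by rewrite -sum_leq; apply: eq_bigr => j _; rewrite inE; case: leqP.
have <- : (\sum_(i < r) (r - i) = 'C(r.+1, 2))%N by rewrite sum_sub // subnn muln0.
by apply: eq_bigr => k _; rewrite -sum_leq; apply: eq_bigr => j _; rewrite inE; case: leqP.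
Qed.
End Weights.

Local Close Scope ring_scope.

(** * The lower bound *)

Theorem proposition15 (s t n : nat) (hs : 2 <= s) (hst : s < t)
    (hn : 3 * t - 3 <= n) :
  (s - 1) * (n - t + 1) + 'C(t, 2)
    <= wsat (complete n) (complete_bipartite s t).
Proof.
case: s t hs hst hn => [//|m] [//|t] hs; rewrite ltnS => hst hn.
have Hn0 : edges (complete_bipartite m.+1 t.+1) != set0.
  by apply/set0Pn; exists [set inl ord0; inr ord0]; apply/imset2P; exists ord0 ord0.
have [G wG <-] := wsat_attained (complete n) Hn0.
(* Here m and t are one less than the sizes of the two sides, so r is the difference of these sizes
   and m + r = t is the degree bound that [beta] annihilates. *)
pose r := t - m.
rewrite (_ : _ + _ = #|free_params m r n|); last first.
  rewrite card_free_params; last lia.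
  have -> : t.+1 = m.+1 + r by lia.
  rewrite bin2D [in RHS](binS r) bin1 subSS subn0.
  have -> : n - m = n - (m.+1 + r) + 1 + r by lia.
  lia.
rewrite leqNgt; apply/negP => ltG.
have [theta [[x thx] supp thG]] := nontrivial_solution (@edge_weight m r n) ltG.
pose Z := [pred e : {set 'I_n} | \sum_x theta x * edge_weight x e == 0]%R.
have closedZ (f : {ffun 'I_m.+1 + 'I_t.+1 -> 'I_n}) : injective f ->
    forall e0, e0 \in edges (complete_bipartite m.+1 t.+1) ->
    (forall e, e \in edges (complete_bipartite m.+1 t.+1) -> e != e0 -> Z (f @: e)) ->
    Z (f @: e0).
  move=> injf e0 /imset2P[i0 j0 _ _ ->] Zf.
  pose fl i : nat := f (inl i); pose fr j : nat := f (inr j).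
  have natr_inj : injective (fun k => k%:R : rat)%R.
    by move=> a b /eqP; rewrite eqr_nat => /eqP.
  have [|alpha [alpha0 alphaP]] := @vandermonde_relation rat m (fun i => (fl i)%:R)%R.
    by move=> i i' /natr_inj/val_inj/injf[].
  have [|beta [beta0 betaP]] := @vandermonde_relation rat t (fun j => (fr j)%:R)%R.
    by move=> j j' /natr_inj/val_inj/injf[].
  pose L i j := (\sum_x theta x * weight x (fl i) (fr j))%R.
  have imf i j : f @: [set inl i; inr j] = [set f (inl i); f (inr j)].
    by rewrite imsetU1 imset_set1.
  have LE i j : Z (f @: [set inl i; inr j]) = (L i j == 0%R).
    rewrite imf /Z /=; congr (_ == _); apply: eq_bigr => y _.
    by rewrite edge_weight2 // (inj_eq injf).
  have L0 i j : (i != i0) || (j != j0) -> L i j = 0%R.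
    move=> nij; apply/eqP; rewrite -LE; apply: Zf; first by apply/imset2P; exists i j.
    apply: contraTneq nij => /setP eqe.
    have := eqe (inl i); have := eqe (inr j); rewrite !inE !eqxx /=.
    by move=> /esym/eqP[->] /esym/orP[/eqP[->]|//]; rewrite !eqxx.
  (* In the relation of the copy only the (i0, j0) term can be nonzero, and its coefficient
     [alpha i0 * beta j0] is nonzero. *)
  rewrite LE; have : (\sum_i \sum_j alpha i * beta j * L i j = 0)%R.
    transitivity (\sum_x theta x * \sum_i \sum_j
        alpha i * beta j * weight x (fl i) (fr j))%R.
      symmetry; under eq_bigr do rewrite big_distrr /=.
      rewrite exchange_big; apply: eq_bigr => i _ /=.
      under eq_bigr do rewrite big_distrr /=.
      rewrite exchange_big; apply: eq_bigr => j _ /=.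
      by rewrite big_distrr; apply: eq_bigr => y _; rewrite /= mulrCA.
    rewrite big1 // => y _; rewrite weight_relation ?mulr0 // => P szP.
    by apply: betaP; apply: leq_trans szP _; rewrite /r; lia.
  rewrite (bigD1 i0) //= [X in (_ + X)%R]big1 ?addr0 => [|i ni]; last first.
    by apply: big1 => j _; rewrite L0 ?ni ?mulr0.
  rewrite (bigD1 j0) //= [X in (_ + X)%R]big1 ?addr0 => [|j nj]; last first.
    by rewrite L0 ?nj ?orbT ?mulr0.
  by move/eqP; rewrite !mulf_eq0 (negPf (alpha0 _)) (negPf (beta0 _)).
have ZF := weakly_saturated_closed closedZ wG (fun e eG => introT eqP (thG e eG)).
case/eqP: thx; apply: (weight_injective (m := m) (r := r) (n := n)) => //; first lia.
move=> a b nab; have := ZF [set a; b]; rewrite inE cards2 nab => /(_ isT)/eqP eq0.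
by rewrite -[RHS]eq0; apply: eq_bigr => y _; rewrite edge_weight2.
Qed.
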